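(* Let $f(x),g(x)\in\mathbb{Z}[x]$ be non-zero polynomials. Then, for every choice of the pairwise distinct auxiliary primes $q_1,\dots,q_{k+1}$ and of the pairwise distinct main primes $p$ made during its execution, the procedure BPN+ described in the context terminates after finitely many steps and outputs a greatest common divisor of $f(x)$ and $g(x)$ in $\mathbb{Z}[x]$.
   Context: Notation. For a non-zero polynomial $u(x)=u_0x^n+\cdots+u_n\in\mathbb{Z}[x]$ with $u_0\neq0$: $\mathrm{lc}(u)=u_0$; $\|u\|=\sqrt{\sum_{i=0}^n u_i^2}$; $\mathrm{cont}(u)$ is the gcd of the coefficients, with sign chosen equal to the sign of $\mathrm{lc}(u)$; $\mathrm{pp}(u)=u/\mathrm{cont}(u)$. Greatest common divisors in $\mathbb{Z}[x]$ are defined up to sign. For a prime $p$, $u_p(x)\in\mathbb{Z}_p[x]$ is the coefficientwise reduction of $u$ modulo $p$, where $\mathbb{Z}_p=\{0,\dots,p-1\}$ is the field of residues modulo $p$. $p_k\#=p_1p_2\cdots p_k$ is the product of the first $k$ primes ($p_1=2$, $p_2=3$, ...). For polynomials $f,g$ of degrees $n,m$, $$A_{f,g}=2^{2nm-n-m}\sqrt{(n+1)^m(m+1)^n}\cdot\|f\|^m\|g\|^n .$$ Reconstruction: for $v(x)\in\mathbb{Z}_p[x]$, its reconstructed pre-image is the polynomial in $\mathbb{Z}[x]$ obtained by replacing each coefficient $b\in\{0,\dots,p-1\}$ of $v$ by $b$ if $b<p/2$ and by $b-p$ otherwise. Procedure BPN+ on input $f,g$: (1) Set $r=\gcd(\mathrm{cont}(f),\mathrm{cont}(g))\in\mathbb{Z}$,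 and replace $f$ by $\mathrm{pp}(f)$ and $g$ by $\mathrm{pp}(g)$. (2) Let $k$ be the largest number for which $p_k\#\le A_{f,g}$ (for the new $f,g$). Set $a_0=\mathrm{lc}(f)>0$, $b_0=\mathrm{lc}(g)>0$, $w=\gcd(a_0,b_0)>0$. (3) Choose pairwise distinct primes $q_1,\dots,q_{k+1}$, none dividing $w$, and successively compute gcd's $e_{q_i}(x)$ of $f_{q_i}(x),g_{q_i}(x)$ in $\mathbb{Z}_{q_i}[x]$, $i=1,\dots,k+1$. If $\deg e_{q_i}=0$ for some $i$, output $r$ and stop. Otherwise set $s=\min\{\deg e_{q_1},\dots,\deg e_{q_{k+1}}\}$. (4) Set $$M=2^{s}\cdot w\cdot\min\left\{\frac{\|f\|}{a_0},\frac{\|g\|}{b_0}\right\}.$$ (5) Choose a new prime $p>2M$ (different from all main primes chosen before) and compute a gcd $e_p(x)$ of $f_p(x),g_p(x)$ in $\mathbb{Z}_p[x]$ by the Euclidean algorithm. If $\deg e_p(x)\ne s$, repeat (5). (6) If $\deg e_p(x)=s$, choose $t\in\mathbb{Z}_p$ with $\mathrm{lc}(t\cdot e_p(x))=w$ in $\mathbb{Z}_p$, let $k(x)\in\mathbb{Z}[x]$ be the reconstructed pre-image of $t\cdot e_p(x)$, set $d(x)=\mathrm{pp}(k(x))$, output $r\cdot d(x)$ and stop.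
   Formalization: If exactly one of the primitive parts is constant (e.g. f = x, g = 1, where A = 1/2), no k satisfies p_k# ≤ A and step (2) is undefined; the formal statement takes k = 0 in that case (with p_0# = 1), so a single auxiliary prime is used. *)

(* Defs.v *)
From mathcomp Require Import all_boot all_order all_algebra.
From Stdlib Require Export Relation_Operators.

Set Implicit Arguments.
Unset Strict Implicit.
Unset Printing Implicit Defensive.

Import Order.TTheory GRing.Theory Num.Theory.
Local Open Scope ring_scope.

(* Divisibility in Z[x]; polydiv's %| on {poly int} is only divisibility up to
   a nonzero integer factor, so it is not used for gcds in Z[x]. *)
Definition dvdZX (u v : {poly int}) : Prop := exists c, v = u * c.

Definition is_gcdZX (d f g : {poly int}) : Prop :=
  [/\ dvdZX d f, dvdZX d g & forall u, dvdZX u f -> dvdZX u g -> dvdZX u d].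

Definition deg (A : nzRingType) (u : {poly A}) : nat := (size u).-1.

Definition norm2 (R : rcfType) (u : {poly int}) : R :=
  Num.sqrt (\sum_(i < size u) (u`_i)%:~R ^+ 2).

Definition lcgcd (f g : {poly int}) : int := gcdz (lead_coef f) (lead_coef g).

(* The power of 2 has an integer exponent, which is negative when exactly one
   of the two degrees is 0. *)
Definition boundA (R : rcfType) (f g : {poly int}) : R :=
  let n := deg f in let m := deg g in
  2 ^ ((2 * n * m)%:Z - n%:Z - m%:Z)
  * Num.sqrt (((n.+1 ^ m)%N * (m.+1 ^ n)%N)%:R)
  * norm2 R f ^+ m * norm2 R g ^+ n.

Definition boundM (R : rcfType) (s : nat) (f g : {poly int}) : R :=
  2 ^+ s * (lcgcd f g)%:~R
  * Num.min (norm2 R f / (lead_coef f)%:~R) (norm2 R g / (lead_coef g)%:~R).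

Lemma ex_next_prime n : exists p, (n < p)%N && prime p.
Proof. by have [p lt_np pr_p] := prime_above n; exists p; rewrite lt_np. Qed.

Definition next_prime (n : nat) : nat := ex_minn (ex_next_prime n).

(* nth_prime 0 = 2, nth_prime 1 = 3, and so on. *)
Definition nth_prime (i : nat) : nat := iter i.+1 next_prime 0%N.

Definition primorial (k : nat) : nat := (\prod_(i < k) nth_prime i)%N.

(* k is the largest number with primorial k <= A, where primorial 0 = 1.  If
   A < 1 there is no such number, and then k = 0. *)
Definition max_primorial (R : rcfType) (A : R) (k : nat) : Prop :=
  (forall j, (primorial j)%:R <= A -> (j <= k)%N)
  /\ ((primorial k)%:R <= A \/ k = 0%N).

Definition redp (p : nat) (u : {poly int}) : {poly 'F_p} := map_poly intr u.

Definition is_gcdp (p : nat) (e : {poly 'F_p}) (f g : {poly int}) : Prop :=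
  e %= gcdp (redp p f) (redp p g).

(* For p prime, the coercion of b : 'F_p to nat is its residue in
   {0, ..., p-1}. *)
Definition recon_coef (p : nat) (b : 'F_p) : int :=
  if ((b : nat).*2 < p)%N then (b : nat)%:Z else (b : nat)%:Z - p%:Z.

Definition reconstruct (p : nat) (v : {poly 'F_p}) : {poly int} :=
  map_poly (@recon_coef p) v.

(* Minimum of a nonempty list. *)
Definition seq_min (ds : seq nat) : nat := foldr minn (head 0%N ds) ds.

(* BPN+ is a nondeterministic transition system: a transition exists for each
   admissible choice of primes, of gcds modulo them (which are determined up
   to a unit only) and of the normalizing constant t.  In the states:
   - r is the gcd of the contents, and f, g are the primitive parts;
   - Auxiliary r f g qs ds: qs are the auxiliary primes still to be processed,
     ds the degrees found for those already processed;
   - Main r f g s ps: s is the minimum of the degrees found, ps the main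
     primes already tried and rejected. *)
Inductive bpn_state : Type :=
  | Input (f g : {poly int})
  | Primitive (r : int) (f g : {poly int})
  | Auxiliary (r : int) (f g : {poly int}) (qs ds : seq nat)
  | Main (r : int) (f g : {poly int}) (s : nat) (ps : seq nat)
  | Output (d : {poly int}).

Inductive bpn_step (R : rcfType) : bpn_state -> bpn_state -> Prop :=
  | step_primitive f g :
      bpn_step R (Input f g)
        (Primitive (gcdz (zcontents f) (zcontents g))
                   (zprimitive f) (zprimitive g))
  | step_choose_aux r f g k qs :
      max_primorial (boundA R f g) k ->
      size qs = k.+1 -> uniq qs ->
      (forall q, q \in qs -> prime q /\ ~~ (q%:Z %| lcgcd f g)%Z) ->
      bpn_step R (Primitive r f g) (Auxiliary r f g qs [::])
  | step_aux_stop r f g q qs ds (e : {poly 'F_q}) :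
      is_gcdp e f g -> deg e = 0%N ->
      bpn_step R (Auxiliary r f g (q :: qs) ds) (Output r%:P)
  | step_aux_next r f g q qs ds (e : {poly 'F_q}) :
      is_gcdp e f g -> deg e <> 0%N ->
      bpn_step R (Auxiliary r f g (q :: qs) ds)
                 (Auxiliary r f g qs (rcons ds (deg e)))
  | step_aux_done r f g ds :
      bpn_step R (Auxiliary r f g [::] ds) (Main r f g (seq_min ds) [::])
  | step_main_repeat r f g s ps p (e : {poly 'F_p}) :
      prime p -> 2 * boundM R s f g < p%:R -> p \notin ps ->
      is_gcdp e f g -> deg e <> s ->
      bpn_step R (Main r f g s ps) (Main r f g s (p :: ps))
  | step_main_output r f g s ps p (e : {poly 'F_p}) (t : 'F_p) :
      prime p -> 2 * boundM R s f g < p%:R -> p \notin ps ->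
      is_gcdp e f g -> deg e = s ->
      lead_coef (t *: e) = (lcgcd f g)%:~R ->
      bpn_step R (Main r f g s ps)
                 (Output (r *: zprimitive (reconstruct (t *: e)))).

Definition bpn_reachable (R : rcfType) : bpn_state -> bpn_state -> Prop :=
  clos_refl_trans bpn_state (bpn_step R).

Definition bpn_infinite_run (R : rcfType) (st : bpn_state) : Prop :=
  exists run : nat -> bpn_state,
    run 0%N = st /\ forall i, bpn_step R (run i) (run i.+1).

(* Main.v *)
Require Import Defs.
From mathcomp Require Import all_boot all_order all_algebra.
From mathcomp Require Import all_fingroup all_field.
From mathcomp Require Import ring zify.

Set Implicit Arguments.
Unset Strict Implicit.
Unset Printing Implicit Defensive.

Import Order.TTheory GRing.Theory Num.Theory.
Local Open Scope ring_scope.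

(** Let f and g be primitive, d a gcd of them in Z[x], f = d F and g = d G, and let
    w be the gcd of the leading coefficients. Since lc(d) divides w, for a prime p
    not dividing w the reduction of d keeps its degree and divides the gcd modulo
    p, so that gcd has degree at least deg d. Call p bad when its degree is larger:
    then the reductions of F and G have a common factor, and p divides the nonzero
    resultant N of F and G ([resultant_bad_prime]).

    The number of auxiliary primes is adapted to the inequality |N| <= A. Expanding
    the determinant of the Sylvester matrix row by row bounds |N| by powers of the
    sums of absolute values of the coefficients of F and G ([norm_resultant_le]).
    These are controlled by Mignotte's inequality for factors ([mignotte]), which
    rests on Landau's inequality for the Mahler measure ([landau_roots]);
    [exceptional_integer] combines them. A product of k + 1 distinct primes is at
    least the primorial of k + 1, hence larger than A, so it cannot divide N and one
    of the auxiliary primes is good ([some_good_prime]): the minimum s of the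
    degrees is deg d. (If F or G is constant, no prime is bad, whatever A is.) An
    auxiliary gcd of degree 0 forces d = 1, since its degree is at least deg d.

    A main prime p > 2 M does not divide w, because w <= M. If it is rejected, it is
    bad and divides N, and the main primes are distinct, so only finitely many are
    rejected. If it is accepted, then t e is the reduction of (w / lc(d)) d, a
    polynomial whose coefficients are at most M < p / 2 in absolute value, by
    Mignotte's inequality again; so it is recovered exactly and its primitive part
    is d ([main_output]). Multiplying by the gcd of the contents gives a gcd of the
    original polynomials ([is_gcdZX_scale]).

    These facts are preserved along executions ([bpn_invariant_step]); every
    non-output state that satisfies them has a successor ([bpn_progress]). *)

(** * Norms of polynomials *)

Lemma degM (A : idomainType) (u v : {poly A}) : u != 0 -> v != 0 ->
  deg (u * v) = (deg u + deg v)%N.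
Proof.
move=> nz_u nz_v; rewrite /deg size_mul //.
move: nz_u nz_v; rewrite -!size_poly_gt0.
by case: (size u) => // a; case: (size v) => // b _ _; rewrite addSn addnS.
Qed.

Definition sqnorm (A : numDomainType) (p : {poly A}) : A :=
  \sum_(i < size p) `|p`_i| ^+ 2.

Definition onenorm (A : numDomainType) (p : {poly A}) : A :=
  \sum_(i < size p) `|p`_i|.

Lemma sum_coef_widen (A : nzRingType) (B : zmodType) (h : A -> B) (p : {poly A}) n :
  h 0 = 0 -> (size p <= n)%N -> \sum_(i < size p) h p`_i = \sum_(i < n) h p`_i.
Proof.
move=> h0 le_pn; rewrite (big_ord_widen n (fun i => h p`_i)) // big_mkcond /=.
by apply: eq_bigr => i _; case: ltnP => // /(nth_default _) ->; rewrite h0.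
Qed.

Lemma sqnorm_widen (A : numDomainType) (p : {poly A}) n :
  (size p <= n)%N -> sqnorm p = \sum_(i < n) `|p`_i| ^+ 2.
Proof.
by apply: (@sum_coef_widen A A (fun x => `|x| ^+ 2)); rewrite normr0 expr0n.
Qed.

Lemma onenorm_widen (A : numDomainType) (p : {poly A}) n :
  (size p <= n)%N -> onenorm p = \sum_(i < n) `|p`_i|.
Proof. by apply: (@sum_coef_widen A A Num.norm); rewrite normr0. Qed.

Lemma onenormZ (A : numDomainType) (a : A) (p : {poly A}) :
  onenorm (a *: p) = `|a| * onenorm p.
Proof.
rewrite (onenorm_widen (size_scale_leq a p)) mulr_sumr.
by apply: eq_bigr => i _; rewrite coefZ normrM.
Qed.

(** * The inequalities of Landau and Mignotte *)

Section Landau.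

Variable C : numClosedFieldType.
Implicit Types (p q : {poly C}) (z : C) (zs : seq C).

(** Replacing a root z != 0 by its reflection 1/z^* in the unit circle and scaling
    the leading coefficient by - z^* preserves the 2-norm: the cross terms of
    corresponding coefficients agree, and the differences of the remaining terms
    telescope. *)
Lemma sqnorm_reflect p z :
  sqnorm (p * ('X - z%:P)) = sqnorm (p * (1 - z^* *: 'X)).
Proof.
set N := size p.
have sz1 : (size (p * ('X - z%:P))%R <= N.+1)%N.
  by apply: leq_trans (size_polyMleq _ _) _; rewrite size_XsubC addnC.
have sz2 : (size (p * (1 - z^* *: 'X))%R <= N.+1)%N.
  apply: leq_trans (size_polyMleq _ _) _; rewrite -/N.
  suff : (size (1 - z^* *: 'X)%R <= 2)%N.
    by move=> le2; rewrite -subn1 leq_subLR add1n -addn2 leq_add2l.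
  rewrite (leq_trans (size_polyD _ _)) // geq_max size_poly1 size_polyN /=.
  by apply: leq_trans (size_scale_leq _ _) _; rewrite size_polyX.
rewrite (sqnorm_widen sz1) (sqnorm_widen sz2) !big_ord_recl /=.
have c1 i : (p * ('X - z%:P))`_i.+1 = p`_i - z * p`_i.+1.
  by rewrite mulrBr coefB coefMX coefMC mulrC.
have c2 i : (p * (1 - z^* *: 'X))`_i.+1 = p`_i.+1 - z^* * p`_i.
  by rewrite mulrBr mulr1 coefB -scalerAr coefZ coefMX.
have -> : (p * ('X - z%:P))`_0 = - (z * p`_0).
  by rewrite mulrBr coefB coefMX coefMC /= sub0r mulrC.
have -> : (p * (1 - z^* *: 'X))`_0 = p`_0.
  by rewrite mulrBr mulr1 coefB -scalerAr coefZ coefMX /= mulr0 subr0.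
apply/eqP; rewrite -subr_eq0 opprD addrACA -sumrB.
under eq_bigr => i _ do rewrite /bump /= !add1n c1 c2.
have -> : \sum_(i < N) (`|p`_i - z * p`_i.+1| ^+ 2 - `|p`_i.+1 - z^* * p`_i| ^+ 2)
        = (`|z| ^+ 2 - 1) * \sum_(i < N) (`|p`_i.+1| ^+ 2 - `|p`_i| ^+ 2).
  rewrite mulr_sumr; apply: eq_bigr => i _.
  by rewrite !normCK !rmorphB !rmorphM /= conjCK; ring.
have -> : \sum_(i < N) (`|p`_i.+1| ^+ 2 - `|p`_i| ^+ 2) = - `|p`_0| ^+ 2.
  rewrite -(big_mkord xpredT (fun i => `|p`_i.+1| ^+ 2 - `|p`_i| ^+ 2)).
  by rewrite telescope_sumr // [p`_N]nth_default // normr0 expr0n sub0r.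
by rewrite normrN normrM; apply/eqP; ring.
Qed.

Lemma lead_coef_reflect p z : z != 0 ->
  lead_coef (p * (1 - z^* *: 'X)) = - (z^* * lead_coef p).
Proof.
move=> nz_z; rewrite lead_coefM addrC lead_coefDl ?lead_coefN ?lead_coefZ.
  by rewrite lead_coefX mulr1 mulrN mulrC.
by rewrite size_polyN size_scale ?conjC_eq0 // size_poly1 size_polyX.
Qed.

Lemma max1_norm_ge1 z : 1 <= Num.max 1 `|z|.
Proof.
by have [|/ltW] := real_leP (normr_real z) (real1 _); rewrite ?lexx.
Qed.

Lemma max1_norm_ge z : `|z| <= Num.max 1 `|z|.
Proof. by have [] := real_leP (normr_real z) (real1 _). Qed.

(** Landau's inequality. Reflecting every root outside the unit disc preserves the
    2-norm and moves the product of the absolute values of these roots into the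
    leading coefficient, which is bounded by the 2-norm. The extra factor p
    collects the linear factors already treated. *)
Lemma landau_roots zs p :
  (`|lead_coef p| * \prod_(z <- zs) Num.max 1 `|z|) ^+ 2
    <= sqnorm (p * \prod_(z <- zs) ('X - z%:P)).
Proof.
elim: zs p => [|z zs IHzs] p.
  rewrite !big_nil !mulr1 /sqnorm; have [->|nz_p] := eqVneq p 0.
    by rewrite lead_coef0 normr0 expr0n size_poly0 big_ord0.
  rewrite (polySpred nz_p) big_ord_recr /= lead_coefE lerDr.
  by apply: sumr_ge0 => i _; rewrite exprn_ge0.
rewrite !big_cons; have [le_z1|lt_1z] := real_leP (normr_real z) (real1 _).
  rewrite mul1r mulrA.
  apply: le_trans (IHzs _); rewrite lead_coefM lead_coefXsubC mulr1 //.
have nz_z : z != 0 by rewrite -normr_gt0 (lt_trans ltr01).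
set Q := \prod_(z <- zs) ('X - z%:P) in IHzs *.
have -> : p * (('X - z%:P) * Q) = p * Q * ('X - z%:P) by ring.
rewrite sqnorm_reflect.
have -> : p * Q * (1 - z^* *: 'X) = p * (1 - z^* *: 'X) * Q by ring.
apply: le_trans (IHzs _); rewrite lead_coef_reflect // normrN normrM norm_conjC.
by rewrite [`|z| * `|lead_coef p|]mulrC mulrA.
Qed.

Lemma onenorm_mul_XsubC p z :
  onenorm (p * ('X - z%:P)) <= (1 + `|z|) * onenorm p.
Proof.
set N := size p.
have sz1 : (size (p * ('X - z%:P))%R <= N.+1)%N.
  by apply: leq_trans (size_polyMleq _ _) _; rewrite size_XsubC addnC.
rewrite (onenorm_widen sz1) mulrDl mul1r.
have -> : `|z| * onenorm p = \sum_(i < N.+1) `|z * p`_i|.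
  rewrite (onenorm_widen (leqnSn N)) mulr_sumr.
  by apply: eq_bigr => i _; rewrite normrM.
rewrite [\sum_(i < N.+1) `|z * _|]big_ord_recl big_ord_recl /= addrCA.
apply: lerD.
  by rewrite mulrBr coefB coefMX coefMC /= sub0r normrN mulrC.
rewrite /onenorm -big_split /=; apply: ler_sum => i _.
rewrite /bump /= add1n mulrBr coefB coefMX coefMC /= mulrC.
exact: ler_normB.
Qed.

Lemma onenorm_roots zs :
  onenorm (\prod_(z <- zs) ('X - z%:P))
    <= 2 ^+ size zs * \prod_(z <- zs) Num.max 1 `|z|.
Proof.
elim: zs => [|z zs IHzs].
  by rewrite !big_nil /onenorm size_poly1 big_ord1 coef1 normr1 mulr1.
rewrite !big_cons mulrC; apply: le_trans (onenorm_mul_XsubC _ _) _.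
have -> : 2 ^+ size (z :: zs) * (Num.max 1 `|z| * \prod_(j <- zs) Num.max 1 `|j|)
        = (2 * Num.max 1 `|z|) * (2 ^+ size zs * \prod_(j <- zs) Num.max 1 `|j|).
  by rewrite /= exprS; ring.
apply: ler_pM => //.
- by rewrite addr_ge0.
- exact: sumr_ge0.
by rewrite mulr_natl mulr2n lerD ?(max1_norm_ge1, max1_norm_ge).
Qed.

End Landau.

(** With M the Mahler measure (the absolute value of the leading coefficient times
    the product of max(1, |z|) over the roots z), onenorm v <= 2^(deg v) M(v), and
    M(v) / |lc(v)| <= M(u) / |lc(u)| since the roots of v are among those of u,
    and M(u) <= ||u||. The squared form keeps the statement inside Z, although
    the roots live in the algebraic numbers. *)
Lemma mignotte (u v h : {poly int}) : u != 0 -> u = v * h ->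
  (onenorm v * `|lead_coef u|) ^+ 2
    <= (2 ^+ deg v * `|lead_coef v|) ^+ 2 * sqnorm u.
Proof.
move=> nz_u def_u.
pose toC := map_poly (intr : int -> algC).
have sq_toC p : sqnorm (toC p) = (sqnorm p)%:~R.
  rewrite /sqnorm size_map_inj_poly ?rmorph0 //; last exact: intr_inj.
  by rewrite rmorph_sum; apply: eq_bigr => i _; rewrite coef_map rmorphXn /= intr_norm.
have one_toC p : onenorm (toC p) = (onenorm p)%:~R.
  rewrite /onenorm size_map_inj_poly ?rmorph0 //; last exact: intr_inj.
  by rewrite rmorph_sum; apply: eq_bigr => i _; rewrite coef_map /= intr_norm.
have lead_toC p : lead_coef (toC p) = (lead_coef p)%:~R.
  by rewrite lead_coef_map_inj //; exact: intr_inj.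
have [zv def_v] := closed_field_poly_normal (toC v).
have [zh def_h] := closed_field_poly_normal (toC h).
have [nz_v nz_h] : v != 0 /\ h != 0.
  by move: nz_u; rewrite def_u mulf_eq0 negb_or => /andP.
have sz_v : size zv = deg v.
  have : size (toC v) = size v.
    by rewrite size_map_inj_poly ?rmorph0 //; exact: intr_inj.
  rewrite def_v size_scale; last by rewrite lead_toC intr_eq0 lead_coef_eq0.
  by rewrite size_prod_XsubC /deg => <-.
rewrite -(ler_int algC) [leLHS]rmorphXn [leRHS]rmorphM.
rewrite [X in _ <= X * _]rmorphXn /= !rmorphM rmorphXn /=.
rewrite -sq_toC -one_toC !intr_norm -!lead_toC.
pose m (z : algC) := Num.max 1 `|z|.
have m_ge1 z : 1 <= m z by apply: max1_norm_ge1.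
have landau_u : (`|lead_coef (toC u)| * \prod_(z <- zv ++ zh) m z) ^+ 2
    <= sqnorm (toC u).
  suff {2}-> : toC u = (lead_coef (toC u))%:P * \prod_(z <- zv ++ zh) ('X - z%:P).
    by have := landau_roots (zv ++ zh) (lead_coef (toC u))%:P; rewrite lead_coefC.
  have -> : toC u = toC v * toC h by rewrite def_u /toC rmorphM.
  rewrite lead_coefM big_cat /= {1}def_v {1}def_h.
  by rewrite -!mul_polyC polyCM; ring.
have one_v : onenorm (toC v)
    <= `|lead_coef (toC v)| * (2 ^+ deg v * \prod_(z <- zv) m z).
  rewrite {1}def_v; set a := lead_coef _; set P := \prod_(z <- zv) ('X - _).
  by rewrite onenormZ ler_wpM2l // -sz_v onenorm_roots.
have le_roots : \prod_(z <- zv) m z <= \prod_(z <- zv ++ zh) m z.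
  rewrite big_cat /= ler_peMr //; last first.
    by apply: (big_ind (fun x => 1 <= x)) => // x y; apply: mulr_ege1.
  by apply: prodr_ge0 => z _; apply: le_trans ler01 (m_ge1 z).
apply: le_trans (_ : (2 ^+ deg v * `|lead_coef (toC v)|) ^+ 2 *
  (`|lead_coef (toC u)| * \prod_(z <- zv ++ zh) m z) ^+ 2 <= _); last first.
  by rewrite ler_wpM2l // exprn_ge0 // mulr_ge0 // exprn_ge0.
rewrite -exprMn ler_pXn2r ?nnegrE //.
- rewrite mulrCA [in leLHS]mulrC; apply: ler_wpM2l => //.
  apply: le_trans one_v _; rewrite mulrA [X in X * _ <= _]mulrC.
  by apply: ler_wpM2l le_roots; rewrite mulr_ge0 // exprn_ge0.
- by rewrite mulr_ge0 // sumr_ge0.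
- rewrite !mulr_ge0 // ?exprn_ge0 //.
  by apply: prodr_ge0 => z _; apply: le_trans ler01 (m_ge1 z).
Qed.

(** * A size bound for resultants *)

(** The expanded product of row sums contains, up to sign, every term of the
    Leibniz formula, plus nonnegative terms for the maps that are not
    permutations. *)
Lemma norm_det_le (A : numDomainType) n (M : 'M[A]_n) :
  `|\det M| <= \prod_i \sum_j `|M i j|.
Proof.
rewrite bigA_distr_bigA /= (bigID (fun s : {ffun _} => injectiveb s)) /=.
rewrite (reindex (@pval _)) /=; last first.
  pose in_Sn := insubd (1%g : {perm 'I_n}).
  by exists in_Sn => /= s Us; first apply: val_inj; apply: insubdK.
apply: ler_wpDr; first by apply: sumr_ge0 => s _; apply: prodr_ge0.
rewrite [leRHS](eq_bigl xpredT) => [|s]; last exact: (valP s).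
apply: le_trans (ler_norm_sum _ _ _) _; apply: ler_sum => s _.
by rewrite normrM normr_sign mul1r normr_prod pvalE. 
Qed.

Lemma onenorm_ge_prefix (A : numDomainType) (p : {poly A}) n :
  \sum_(i < n) `|p`_i| <= onenorm p.
Proof.
rewrite (onenorm_widen (leq_maxl (size p) n)).
rewrite (big_ord_widen _ (fun i => `|p`_i|) (leq_maxr (size p) n)) big_mkcond.
by apply: ler_sum => i _; case: ifP.
Qed.

Lemma onenorm_ge_shift (A : numDomainType) (p : {poly A}) n k :
  \sum_(j < n) `|p`_(j - k) *+ (k <= j)| <= onenorm p.
Proof.
elim: k n => [|k IHk] n.
  by under eq_bigr => j _ do rewrite subn0 mulr1n; exact: onenorm_ge_prefix.
case: n => [|n]; first by rewrite big_ord0 sumr_ge0.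
by rewrite big_ord_recl /= normr0 add0r; exact: IHk.
Qed.

(** Each row of the Sylvester matrix is a shifted copy of the coefficients of one
    of the polynomials, so this is the row sum bound for determinants. *)
Lemma norm_resultant_le (A : numDomainType) (p q : {poly A}) :
  `|resultant p q| <= onenorm p ^+ deg q * onenorm q ^+ deg p.
Proof.
apply: le_trans (norm_det_le _) _.
rewrite big_split_ord /= /deg -[in X in _ <= X * _](card_ord (size q).-1).
rewrite -[in X in _ <= _ * X](card_ord (size p).-1) -!prodr_const.
apply: ler_pM; try by apply: prodr_ge0 => i _; apply: sumr_ge0.
  apply: ler_prod => i _; rewrite sumr_ge0 //=.
  under eq_bigr => j _ do rewrite Sylvester_mxE (unsplitK (inl _ i)).
  exact: onenorm_ge_shift.
apply: ler_prod => i _; rewrite sumr_ge0 //=.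
under eq_bigr => j _ do rewrite Sylvester_mxE (unsplitK (inr _ i)).
exact: onenorm_ge_shift.
Qed.

(** Cauchy-Schwarz against the all-ones vector, by summing
    2|a||b| <= |a|^2 + |b|^2 over all pairs of coefficients. *)
Lemma sqr_onenorm_le (p : {poly int}) :
  onenorm p ^+ 2 <= (size p)%:R * sqnorm p.
Proof.
rewrite -(ler_pM2l (ltr0n _ 2)) [leRHS]mulrA.
have -> : onenorm p ^+ 2 = \sum_(i < size p) \sum_(j < size p) `|p`_i| * `|p`_j|.
  by rewrite expr2 /onenorm mulr_suml; apply: eq_bigr => i _; rewrite mulr_sumr.
have -> : 2%:R * (size p)%:R * sqnorm p
   = \sum_(i < size p) \sum_(j < size p) (`|p`_i| ^+ 2 + `|p`_j| ^+ 2).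
  under eq_bigr => i _ do rewrite big_split /= sumr_const card_ord.
  rewrite big_split /= sumr_const card_ord sumrMnl -/(sqnorm p).
  by rewrite mulr_natl -mulr_natr -[sqnorm p *+ size p]mulr_natr; ring.
rewrite mulr_sumr; apply: ler_sum => i _; rewrite mulr_sumr.
apply: ler_sum => j _.
by have := sqr_ge0 (`|p`_i| - `|p`_j|); rewrite -subr_ge0; congr (0 <= _); ring.
Qed.

(** * Greatest common divisors in Z[x] *)

Lemma primitive_neq0 (u : {poly int}) : zcontents u = 1 -> u != 0.
Proof. by move=> u1; rewrite -zcontents_eq0 u1. Qed.

Lemma zprimitive_id1 (u : {poly int}) : zcontents u = 1 -> zprimitive u = u.
Proof. by move=> u1; rewrite [RHS]zpolyEprim u1 scale1r. Qed.

Lemma lead_coef_primitive_gt0 (u : {poly int}) : zcontents u = 1 -> 0 < lead_coef u.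
Proof. by move=> u1; rewrite -sgz_gt0 -sgz_contents u1. Qed.

Lemma primitive_const (u : {poly int}) : zcontents u = 1 -> (size u <= 1)%N -> u = 1.
Proof.
move=> u1 /size1_polyC def_u; move: u1.
rewrite def_u -[_%:P]mulr1 mul_polyC zcontentsZ zcontents_monic ?monic1 //.
by rewrite mulr1 => ->; rewrite scale1r.
Qed.

(** The pseudo-gcd over the integral domain Z is a gcd up to an integer factor
    only; its primitive part is a true gcd by Gauss's lemma, here in the form
    that a primitive pseudo-divisor is a divisor. *)
Lemma primitive_gcd (f g : {poly int}) : zcontents f = 1 -> zcontents g = 1 ->
  exists d F G : {poly int},
    [/\ f = d * F, g = d * G, zcontents d = 1 & size (gcdp F G) = 1%N]
    /\ is_gcdZX d f g.
Proof.
move=> f1 g1; pose h := gcdp f g; pose d := zprimitive h.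
have nz_f := primitive_neq0 f1; have nz_g := primitive_neq0 g1.
have nz_h : h != 0 by rewrite gcdp_eq0 negb_and nz_f.
have [F def_f] := dvdpP_int (dvdp_gcdl f g).
have [G def_g] := dvdpP_int (dvdp_gcdr f g).
exists d, F, G; split; last first.
  split; [by exists F | by exists G |].
  move=> u [a def_fu] [b def_gu].
  have dvd_uh : u %| h by rewrite dvdp_gcd {1}def_fu def_gu !dvdp_mulr.
  have [c def_h] := dvdpP_int dvd_uh.
  have u_unit : zcontents u * zcontents a = 1 by rewrite -zcontentsM -def_fu.
  exists (zcontents a *: zprimitive c).
  rewrite /d def_h zprimitiveM zprimitive_id [in RHS](zpolyEprim u).
  by rewrite -scalerAl -scalerAr scalerA u_unit scale1r.
split=> //; first by rewrite zcontents_primitive nz_h.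
have : size h = size (d * gcdp F G).
  by rewrite -(eqp_size (gcdp_mul2l d F G)) -def_f -def_g.
have nz_FG : gcdp F G != 0.
  by rewrite gcdp_eq0 negb_and; apply/orP; left; apply: contraNneq nz_f => F0;
     rewrite def_f F0 mulr0.
have nz_d : d != 0 by rewrite zprimitive_eq0.
rewrite size_mul // size_zprimitive; have : (0 < size h)%N by rewrite size_poly_gt0.
by case: (size h) => // n _; rewrite addSn /= -addn1 => /addnI ->.
Qed.

(** Z[x]-divisibility splits into divisibility of the contents in Z and of the
    primitive parts, so the two gcds can be computed separately. *)
Lemma is_gcdZX_scale (f g d : {poly int}) :
  is_gcdZX d (zprimitive f) (zprimitive g) ->
  is_gcdZX (gcdz (zcontents f) (zcontents g) *: d) f g.
Proof.
set r := gcdz _ _; move=> [[F def_f] [G def_g] max_d].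
have dvd_scale a (u v : {poly int}) b :
    (a %| b)%Z -> dvdZX u v -> dvdZX (a *: u) (b *: v).
  move=> /dvdzP[x ->] [y ->]; exists (x *: y).
  by rewrite -scalerAl -scalerAr scalerA mulrC.
split.
- rewrite [in X in dvdZX _ X](zpolyEprim f); apply: dvd_scale.
    exact: dvdz_gcdl.
  by exists F.
- rewrite [in X in dvdZX _ X](zpolyEprim g); apply: dvd_scale.
    exact: dvdz_gcdr.
  by exists G.
move=> u [a def_fu] [b def_gu]; rewrite [u]zpolyEprim; apply: dvd_scale.
  rewrite /r dvdz_gcd def_fu def_gu !zcontentsM.
  by apply/andP; split; apply: dvdz_mulr; apply: dvdzz.
apply: max_d; [exists (zprimitive a) | exists (zprimitive b)].
  by rewrite def_fu zprimitiveM.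
by rewrite def_gu zprimitiveM.
Qed.

(** * Good and bad primes *)

Section Reduction.

Variables (p : nat) (pr_p : prime p).

Lemma redp_int_eq0 (a : int) : (a%:~R == 0 :> 'F_p) = (p%:Z %| a)%Z.
Proof. by rewrite (dvdz_pcharf (pchar_Fp pr_p)). Qed.

Lemma redpM (u v : {poly int}) : redp p (u * v) = redp p u * redp p v.
Proof. exact: rmorphM. Qed.

Lemma size_redp (u : {poly int}) :
  ~~ (p%:Z %| lead_coef u)%Z -> size (redp p u) = size u.
Proof. by rewrite -redp_int_eq0 => nz; apply: size_map_poly_id0. Qed.

Lemma lead_coef_redp (u : {poly int}) :
  ~~ (p%:Z %| lead_coef u)%Z -> lead_coef (redp p u) = (lead_coef u)%:~R.
Proof. by rewrite -redp_int_eq0 => nz; apply: lead_coef_map_id0. Qed.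

Section Cofactors.

Variables f g d F G : {poly int}.
Hypotheses (def_f : f = d * F) (def_g : g = d * G).
Hypothesis p_lc : ~~ (p%:Z %| lcgcd f g)%Z.

Lemma lead_factor_dvd : (lead_coef d %| lcgcd f g)%Z.
Proof. by rewrite /lcgcd def_f def_g !lead_coefM dvdz_gcd !dvdz_mulr. Qed.

Lemma lead_factor_redp : ~~ (p%:Z %| lead_coef d)%Z.
Proof.
by apply: contra p_lc => /dvdz_trans; apply; exact: lead_factor_dvd.
Qed.

Lemma gcdp_redp_eq :
  gcdp (redp p f) (redp p g) %= redp p d * gcdp (redp p F) (redp p G).
Proof. by rewrite def_f def_g !redpM; exact: gcdp_mul2l. Qed.

Lemma gcdp_redp_cofactors_neq0 : gcdp (redp p F) (redp p G) != 0.
Proof.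
rewrite gcdp_eq0; apply: contra p_lc => /andP[/eqP F0 /eqP G0].
have redp0 u : redp p u = 0 -> (p%:Z %| lead_coef u)%Z.
  move=> u0; apply: contraT => nd; have := lead_coef_redp nd.
  by rewrite u0 lead_coef0 => /esym/eqP; rewrite redp_int_eq0 (negPf nd).
rewrite /lcgcd dvdz_gcd; apply/andP; split; apply: redp0.
  by rewrite def_f redpM F0 mulr0.
by rewrite def_g redpM G0 mulr0.
Qed.

(** As p does not divide w, reduction preserves the degree of d; the excess over
    it is the degree of a gcd of the reduced cofactors. *)
Lemma deg_gcdp_redp :
  deg (gcdp (redp p f) (redp p g)) =
  (deg d + deg (gcdp (redp p F) (redp p G)))%N.
Proof.
have nz_c := gcdp_redp_cofactors_neq0.
have p_d := lead_factor_redp.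
have sz_d := size_redp p_d.
have nz_d : redp p d != 0.
  rewrite -size_poly_gt0 sz_d size_poly_gt0; apply: contraNneq p_d => ->.
  by rewrite lead_coef0 dvdz0.
rewrite [LHS]/deg (eqp_size gcdp_redp_eq) -/(deg _) degM //.
by rewrite {1}/deg sz_d.
Qed.

(** The resultant is a combination u F + v G over Z; modulo a bad prime, a
    nonconstant common factor of the cofactors divides this constant, which
    must therefore vanish. *)
Lemma resultant_bad_prime : (1 < size F)%N -> (1 < size G)%N ->
  deg (gcdp (redp p f) (redp p g)) <> deg d -> (p%:Z %| resultant F G)%Z.
Proof.
move=> F_gt1 G_gt1; rewrite deg_gcdp_redp => bad.
have [[u v] _ /= def_res] := resultant_in_ideal F_gt1 G_gt1.
rewrite -redp_int_eq0 -polyC_eq0; apply: contraT => nz_res.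
have : gcdp (redp p F) (redp p G) %| (resultant F G)%:~R%:P.
  rewrite -[_%:P](map_polyC (intr : int -> 'F_p)) def_res rmorphD !rmorphM /=.
  by rewrite dvdp_add // dvdp_mull ?dvdp_gcdl ?dvdp_gcdr.
move=> /(dvdp_leq nz_res); move: nz_res; rewrite polyC_eq0 => nz_res.
rewrite size_polyC nz_res => le1; case: bad.
by rewrite /deg; case: size le1 => [|[|]] // n; rewrite addn0.
Qed.

End Cofactors.
End Reduction.

(** * The size of the cofactor resultant *)

Lemma sqnorm_ge0 (u : {poly int}) : 0 <= sqnorm u.
Proof. by apply: sumr_ge0 => i _; rewrite exprn_ge0. Qed.

Lemma onenorm_ge0 (u : {poly int}) : 0 <= onenorm u.
Proof. exact: sumr_ge0. Qed.

Lemma sqr_lead_coef_le (u : {poly int}) : u != 0 -> lead_coef u ^+ 2 <= sqnorm u.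
Proof.
move=> nz_u; rewrite /sqnorm (polySpred nz_u) big_ord_recr /= lead_coefE.
by rewrite real_normK ?num_real // lerDr sumr_ge0 // => i _; rewrite exprn_ge0.
Qed.

Lemma int_normr_ge1 (a : int) : a != 0 -> 1 <= `|a|.
Proof. by rewrite -normr_gt0 gtz0_ge1. Qed.

Lemma sqnorm_ge1 (u : {poly int}) : u != 0 -> 1 <= sqnorm u.
Proof.
move=> nz_u; apply: le_trans (sqr_lead_coef_le nz_u).
by rewrite -gtz0_ge1 exprn_even_gt0 //= lead_coef_eq0.
Qed.

(** Mignotte's inequality without leading coefficients: over Z, that of a factor
    is at most that of the product. *)
Lemma sqr_onenorm_factor_le (u v h : {poly int}) : u != 0 -> u = v * h ->
  onenorm v ^+ 2 <= 4 ^+ deg v * sqnorm u.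
Proof.
move=> nz_u def_u; have := mignotte nz_u def_u.
have [nz_v nz_h] : v != 0 /\ h != 0.
  by move: nz_u; rewrite def_u mulf_eq0 negb_or => /andP.
have lv_gt0 : 0 < `|lead_coef v| by rewrite normr_gt0 lead_coef_eq0.
have -> : lead_coef u = lead_coef v * lead_coef h by rewrite def_u lead_coefM.
have lh_ge1 : 1 <= `|lead_coef h| ^+ 2.
  by rewrite exprn_ege1 // int_normr_ge1 // lead_coef_eq0.
rewrite normrM => le_u; rewrite -(ler_pM2l (exprn_gt0 2 lv_gt0)).
have -> : `|lead_coef v| ^+ 2 * (4 ^+ deg v * sqnorm u)
        = (2 ^+ deg v * `|lead_coef v|) ^+ 2 * sqnorm u.
  by rewrite (_ : 4 = 2 ^+ 2) // -exprM mulnC exprM; ring.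
apply: le_trans le_u.
have -> : (onenorm v * (`|lead_coef v| * `|lead_coef h|)) ^+ 2
  = `|lead_coef v| ^+ 2 * onenorm v ^+ 2 * `|lead_coef h| ^+ 2 by ring.
by apply: ler_peMr => //; rewrite mulr_ge0 // exprn_ge0 // onenorm_ge0.
Qed.

Lemma int_ler_expr (a b : int) n : 0 <= a -> a <= b -> a ^+ n <= b ^+ n.
Proof. by move=> a0 ab; apply: lerXn2r; rewrite ?nnegrE // (le_trans a0). Qed.

Lemma sqr_norm2 (R : rcfType) (u : {poly int}) : norm2 R u ^+ 2 = (sqnorm u)%:~R.
Proof.
rewrite /norm2 sqr_sqrtr; last by apply: sumr_ge0 => i _; rewrite sqr_ge0.
rewrite rmorph_sum; apply: eq_bigr => i _.
by rewrite real_normK ?num_real // rmorphXn.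
Qed.

(** When both degrees are positive the exponent of 2 in A is a natural number, and
    the square of A is an integer. *)
Lemma abs_le_boundA (R : rcfType) (f g : {poly int}) (N : int) :
  (0 < deg f)%N -> (0 < deg g)%N ->
  N ^+ 2 <= 4 ^+ (2 * deg f * deg g - deg f - deg g)%N
     * ((deg f).+1 ^ deg g * (deg g).+1 ^ deg f)%N%:R
     * sqnorm f ^+ deg g * sqnorm g ^+ deg f ->
  `|N|%:~R <= boundA R f g.
Proof.
move=> n_gt0 m_gt0; set n := deg f in n_gt0 *; set m := deg g in m_gt0 *.
set E := (_ - m)%N; set L := (_ * _ ^ _)%N => le_N.
have def_A : boundA R f g
  = 2 ^+ E * Num.sqrt L%:R * norm2 R f ^+ m * norm2 R g ^+ n.
  rewrite /boundA -/n -/m -/L (_ : _%:Z - n%:Z - m%:Z = E%:Z) //.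
  by rewrite /E; nia.
have A_ge0 : 0 <= boundA R f g.
  by rewrite def_A !mulr_ge0 ?exprn_ge0 ?sqrtr_ge0.
rewrite -(@ler_pXn2r _ 2) ?nnegrE ?ler0z // def_A !exprMn.
rewrite sqr_sqrtr ?ler0n // -!exprM ![(_ * 2)%N]mulnC !exprM !sqr_norm2.
have -> : `|N|%:~R ^+ 2 = (N ^+ 2)%:~R :> R.
  by rewrite -[N ^+ 2]real_normK ?num_real // rmorphXn.
move: le_N; rewrite -(ler_int R); congr (_ <= _).
have -> : 2 ^+ 2 = (4 : int)%:~R :> R by rewrite -natrX.
rewrite 3!rmorphM !rmorphXn /=; congr (_ * _ * _ * _); exact: mulrz_nat.
Qed.

(** c, n and m are the degrees of d, F and G. *)
Lemma exponent_ineq n m c : (0 < c)%N ->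
  (2 * (n * m) <= 2 * (c + n) * (c + m) - (c + n) - (c + m))%N.
Proof. nia. Qed.

(** N is the resultant of the cofactors F and G of d, or 1 when one of them is
    constant, hence equal to 1, so that no prime is bad. If d = 1, the factor
    sqrt((n+1)^m (m+1)^n) in A pays for passing from 1-norms of f and g to
    2-norms. If deg d > 0, Mignotte's inequality bounds the 1-norms of F
    and G at the cost of 2^(2 deg F deg G), and the drop in degree makes this at
    most 2^(2nm-n-m). *)
Lemma exceptional_integer (f g d F G : {poly int}) :
  f = d * F -> g = d * G -> zcontents f = 1 -> zcontents g = 1 ->
  zcontents d = 1 -> size (gcdp F G) = 1%N ->
  exists N : int, [/\ N != 0,
    N = 1 \/ forall R : rcfType, `|N|%:~R <= boundA R f g
    & forall p, prime p -> ~~ (p%:Z %| lcgcd f g)%Z ->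
        deg (gcdp (redp p f) (redp p g)) <> deg d -> (p%:Z %| N)%Z].
Proof.
move=> def_f def_g f1 g1 d1 cop.
have nz_f := primitive_neq0 f1; have nz_g := primitive_neq0 g1.
have nz_d := primitive_neq0 d1.
have F1 : zcontents F = 1 by rewrite -f1 def_f zcontentsM d1 mul1r.
have G1 : zcontents G = 1 by rewrite -g1 def_g zcontentsM d1 mul1r.
have nz_F := primitive_neq0 F1; have nz_G := primitive_neq0 G1.
have [F_le1|F_gt1] := leqP (size F) 1.
  exists 1; split; [by [] | by left |] => p pr_p p_lc.
  rewrite (deg_gcdp_redp pr_p def_f def_g p_lc) (primitive_const F1 F_le1).
  rewrite /redp rmorph1.
  by rewrite /deg (eqp_size (gcd1p _)) size_poly1 addn0.
have [G_le1|G_gt1] := leqP (size G) 1.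
  exists 1; split; [by [] | by left |] => p pr_p p_lc.
  rewrite (deg_gcdp_redp pr_p def_f def_g p_lc) (primitive_const G1 G_le1).
  by rewrite /redp rmorph1 /deg (eqp_size (gcdp1 _)) size_poly1 addn0.
exists (resultant F G); split; first by rewrite resultant_eq0 cop.
  right => R.
  have def_n : deg f = (deg d + deg F)%N by rewrite def_f degM.
  have def_m : deg g = (deg d + deg G)%N by rewrite def_g degM.
  have n'_gt0 : (0 < deg F)%N by rewrite /deg -subn1 subn_gt0.
  have m'_gt0 : (0 < deg G)%N by rewrite /deg -subn1 subn_gt0.
  apply: abs_le_boundA; try by rewrite ?def_n ?def_m addn_gt0 ?n'_gt0 ?m'_gt0 orbT.
  have res2 : resultant F G ^+ 2
      <= (onenorm F ^+ 2) ^+ deg G * (onenorm G ^+ 2) ^+ deg F.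
    rewrite -[leLHS]real_normK ?num_real //.
    have := norm_resultant_le F G => /(int_ler_expr 2 (normr_ge0 _)) le_res.
    by apply: le_trans le_res _; rewrite exprMn -!exprM ![(2 * _)%N]mulnC.
  apply: le_trans res2 _.
  have f_ge1 := sqnorm_ge1 nz_f; have g_ge1 := sqnorm_ge1 nz_g.
  have [c0|c_gt0] := posnP (deg d).
    have d_1 : d = 1.
      by apply: primitive_const d1 _; move: c0; rewrite /deg; case: (size d) => [|[|]].
    have -> : F = f by rewrite def_f d_1 mul1r.
    have -> : G = g by rewrite def_g d_1 mul1r.
    have le_f : onenorm f ^+ 2 <= (deg f).+1%:R * sqnorm f.
      by rewrite /deg -polySpred // sqr_onenorm_le.
    have le_g : onenorm g ^+ 2 <= (deg g).+1%:R * sqnorm g.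
      by rewrite /deg -polySpred // sqr_onenorm_le.
    apply: le_trans (ler_pM _ _ (int_ler_expr (deg g) (sqr_ge0 _) le_f)
                                (int_ler_expr (deg f) (sqr_ge0 _) le_g)) _.
    - by rewrite exprn_ge0 // sqr_ge0.
    - by rewrite exprn_ge0 // sqr_ge0.
    set E := (_ - _)%N; rewrite !exprMn natrM !natrX.
    set x := _ ^+ deg g; set y := sqnorm f ^+ _.
    set z := _ ^+ deg f; set w := sqnorm g ^+ _.
    have -> : 4 ^+ E * (x * z) * y * w = 4 ^+ E * (x * y * (z * w)) by ring.
    apply: ler_peMl; last by rewrite exprn_ege1.
    by rewrite !mulr_ge0 ?exprn_ge0 ?sqnorm_ge0.
  have le_F : onenorm F ^+ 2 <= 4 ^+ deg F * sqnorm f.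
    by apply: (@sqr_onenorm_factor_le _ _ d) => //; rewrite mulrC.
  have le_G : onenorm G ^+ 2 <= 4 ^+ deg G * sqnorm g.
    by apply: (@sqr_onenorm_factor_le _ _ d) => //; rewrite mulrC.
  apply: le_trans (ler_pM _ _ (int_ler_expr (deg G) (sqr_ge0 _) le_F)
                              (int_ler_expr (deg F) (sqr_ge0 _) le_G)) _.
  - by rewrite exprn_ge0 // sqr_ge0.
  - by rewrite exprn_ge0 // sqr_ge0.
  set E := (_ - _)%N; set L := (_ * _ ^ _)%N; rewrite !exprMn.
  have -> : (4 ^+ deg F) ^+ deg G * sqnorm f ^+ deg G *
            ((4 ^+ deg G) ^+ deg F * sqnorm g ^+ deg F)
    = 4 ^+ (2 * (deg F * deg G)) * 1 * sqnorm f ^+ deg G * sqnorm g ^+ deg F.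
    by rewrite mul2n -addnn exprD {2}[(deg F * _)%N]mulnC !exprM; ring.
  have pow_le (a : int) i j : 1 <= a -> (i <= j)%N -> a ^+ i <= a ^+ j.
    by move=> a1 ij; apply: ler_weXn2l.
  have L_ge1 : 1 <= L%:R :> int by rewrite ler1n muln_gt0 !expn_gt0.
  apply: ler_pM; rewrite ?mulr_ge0 ?exprn_ge0 ?sqnorm_ge0 //; last first.
    by apply: pow_le => //; rewrite def_n leq_addl.
  apply: ler_pM; rewrite ?mulr_ge0 ?exprn_ge0 ?sqnorm_ge0 //; last first.
    by apply: pow_le => //; rewrite def_m leq_addl.
  apply: ler_pM => //; rewrite ?exprn_ge0 //; apply: pow_le => //.
  by rewrite /E def_n def_m exponent_ineq.
move=> p pr_p p_lc; exact: (resultant_bad_prime pr_p def_f def_g p_lc).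
Qed.

(** * Recovering the gcd modulo a main prime *)

Lemma recon_coef_intr p (a : int) : prime p -> (`|a|%N.*2 < p)%N ->
  recon_coef (a%:~R : 'F_p) = a.
Proof.
move=> pr_p; rewrite /recon_coef; case: a => n; rewrite ?NegzE ?abszN absz_nat => lt_p.
  by rewrite -pmulrn val_Fp_nat // modn_small ?lt_p //; lia.
have le_p : (n.+1 <= p)%N by lia.
have -> : (- n.+1%:Z)%:~R = (p - n.+1)%:R :> 'F_p.
  by rewrite natrB // pchar_Fp_0 // sub0r rmorphN.
rewrite val_Fp_nat // modn_small; last lia.
rewrite ifF; last lia.
by rewrite -subzn //; lia.
Qed.

Lemma reconstruct_redp p (u : {poly int}) : prime p ->
  (forall i, (`|(u`_i)%R|%N.*2 < p)%N) -> reconstruct (redp p u) = u.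
Proof.
move=> pr_p small_u; apply/polyP => i.
have recon0 : recon_coef (0 : 'F_p) = 0.
  by rewrite -[0 in LHS](mulr0z 1) recon_coef_intr // prime_gt0.
by rewrite coef_map_id0 // coef_map recon_coef_intr.
Qed.

Lemma coef_le_onenorm (u : {poly int}) i : `|u`_i| <= onenorm u.
Proof.
have [lt_i|le_i] := ltnP i (size u); last by rewrite nth_default // normr0 sumr_ge0.
by rewrite /onenorm (bigD1 (Ordinal lt_i)) //= lerDl sumr_ge0.
Qed.

Lemma mignotte_norm2 (R : rcfType) (u v h : {poly int}) : u != 0 -> u = v * h ->
  (onenorm v * `|lead_coef u|)%:~R <= (2 ^+ deg v * `|lead_coef v|)%:~R * norm2 R u.
Proof.
move=> nz_u /(mignotte nz_u); rewrite -(ler_int R) [leRHS]rmorphM => le_v.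
have rhs_ge0 : 0 <= 2 ^+ deg v * `|lead_coef v| by rewrite mulr_ge0 // exprn_ge0.
rewrite -(@ler_pXn2r _ 2) ?nnegrE ?ler0z //; last first.
- by rewrite mulr_ge0 ?ler0z // sqrtr_ge0.
- by rewrite mulr_ge0 // onenorm_ge0.
by rewrite exprMn sqr_norm2 -[leLHS]rmorphXn -[X in _ <= X * _]rmorphXn.
Qed.

Lemma eqp_lead_eq (K : fieldType) (u v : {poly K}) :
  u %= v -> lead_coef u = lead_coef v -> u = v.
Proof.
move=> /eqpP[[a b] /= /andP[nz_a nz_b] eq_uv] eq_lead.
have [v0|nz_v] := eqVneq v 0.
  by move/eqP: eq_lead; rewrite v0 lead_coef0 lead_coef_eq0 => /eqP.
have : a * lead_coef v = b * lead_coef v by rewrite -{1}eq_lead -!lead_coefZ eq_uv.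
move/mulIf; rewrite lead_coef_eq0 => /(_ nz_v) eq_ab.
by apply: (scalerI nz_a); rewrite eq_uv eq_ab.
Qed.

(** The polynomial to be recovered is c d with c = w / lc(d), whose leading
    coefficient is w and whose coefficients are at most M. *)
Section MainPrime.

Variables f g d F G : {poly int}.
Hypotheses (def_f : f = d * F) (def_g : g = d * G).
Hypotheses (f1 : zcontents f = 1) (g1 : zcontents g = 1) (d1 : zcontents d = 1).

Let c := (lcgcd f g %/ lead_coef d)%Z.

Lemma lcgcd_gt0 : 0 < lcgcd f g.
Proof.
by rewrite /lcgcd lt_def gcdz_eq0 negb_and lead_coef_eq0 primitive_neq0.
Qed.

Lemma scaled_lead : c * lead_coef d = lcgcd f g.
Proof. exact: (divzK (lead_factor_dvd def_f def_g)). Qed.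

Lemma scale_gt0 : 0 < c.
Proof.
by rewrite -(pmulr_lgt0 _ (lead_coef_primitive_gt0 d1)) scaled_lead lcgcd_gt0.
Qed.

Lemma scaled_onenorm_le (R : rcfType) :
  (c * onenorm d)%:~R <= boundM R (deg d) f g.
Proof.
have main u h : u = d * h -> zcontents u = 1 ->
    (c * onenorm d)%:~R
    <= 2 ^+ deg d * (lcgcd f g)%:~R * (norm2 R u / (lead_coef u)%:~R).
  move=> def_u u1; have lu := lead_coef_primitive_gt0 u1.
  rewrite mulrA ler_pdivlMr ?ltr0z // -rmorphM /=.
  have := mignotte_norm2 R (primitive_neq0 u1) def_u.
  rewrite (gtr0_norm lu) (gtr0_norm (lead_coef_primitive_gt0 d1)) => le_u.
  have c_ge0 : 0 <= c%:~R :> R by rewrite ler0z ltW // scale_gt0.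
  have := ler_wpM2l c_ge0 le_u; rewrite -rmorphM /= !mulrA -rmorphM /=.
  congr (_ <= _ * _); rewrite -scaled_lead mulrCA mulrA !rmorphM rmorphXn /=; ring.
rewrite /boundM; have [_|_] := leP (norm2 R f / _) (norm2 R g / _).
  exact: main def_f f1.
exact: main def_g g1.
Qed.

Lemma small_scaled (R : rcfType) p :
  2 * boundM R (deg d) f g < p%:R -> (`|(c * onenorm d)%R|%N.*2 < p)%N.
Proof.
move=> lt_p; rewrite -(ltr_nat R); apply: le_lt_trans lt_p.
rewrite -mul2n natrM ler_pM2l ?ltr0n // (le_trans _ (scaled_onenorm_le R)) //.
by rewrite pmulrn gez0_abs // mulr_ge0 ?onenorm_ge0 // ltW // scale_gt0.
Qed.

(** Since c d has leading coefficient w, also w <= M < p / 2. *)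
Lemma main_prime_lc (R : rcfType) p :
  2 * boundM R (deg d) f g < p%:R -> ~~ (p%:Z %| lcgcd f g)%Z.
Proof.
move/small_scaled => lt_p; rewrite dvdzE /=; apply: contraL lt_p => dvd_w.
have w_gt0 : (0 < `|lcgcd f g|)%N by rewrite absz_gt0 gt_eqF ?lcgcd_gt0.
have : (`|lcgcd f g| <= `|(c * onenorm d)%R|)%N.
  rewrite -scaled_lead !abszM leq_mul2l -lez_nat !gez0_abs ?onenorm_ge0 //.
    have := coef_le_onenorm d (size d).-1; rewrite -lead_coefE.
    by rewrite (gtr0_norm (lead_coef_primitive_gt0 d1)) => ->; rewrite orbT.
  by rewrite ltW // lead_coef_primitive_gt0.
have := dvdn_leq w_gt0 dvd_w; move: `|_|%N `|_|%N w_gt0 => m n.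
rewrite -leqNgt -addnn => _ le_p le_n.
by apply: leq_trans le_p (leq_trans le_n _); rewrite leq_addr.
Qed.

(** As p is good, t e and the reduction of c d are associated with the same
    leading coefficient w, hence equal; reconstruction then returns c d. *)
Lemma main_output (R : rcfType) p (e : {poly 'F_p}) (t : 'F_p) :
  prime p -> 2 * boundM R (deg d) f g < p%:R ->
  is_gcdp e f g -> deg e = deg d -> lead_coef (t *: e) = (lcgcd f g)%:~R ->
  zprimitive (reconstruct (t *: e)) = d.
Proof.
move=> pr_p lt_p gcd_e deg_e lead_te.
have p_lc := main_prime_lc lt_p.
have p_d := lead_factor_redp def_f def_g p_lc.
have nz_w : (lcgcd f g)%:~R != 0 :> 'F_p by rewrite redp_int_eq0.
have nz_te : t *: e != 0 by rewrite -lead_coef_eq0 lead_te.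
have [nz_t nz_e] : t != 0 /\ e != 0.
  by move: nz_te; rewrite scaler_eq0 negb_or => /andP.
have nz_d := primitive_neq0 d1.
have nz_c : c%:~R != 0 :> 'F_p.
  by apply: contraNneq nz_w => c0; rewrite -scaled_lead rmorphM /= c0 mul0r.
have eqp_ed : redp p d %= e.
  rewrite -dvdp_size_eqp; last first.
    rewrite (eqp_dvdr _ gcd_e) (eqp_dvdr _ (gcdp_redp_eq p def_f def_g)).
    exact: dvdp_mulIl.
  rewrite size_redp //; move: nz_d nz_e deg_e; rewrite -!size_poly_gt0 /deg.
  by case: (size d) => // a; case: (size e) => //= b _ _ ->.
have eq_te : t *: e = redp p (c *: d).
  apply: eqp_lead_eq.
    rewrite (eqp_ltrans (eqp_scale e nz_t)) /redp map_polyZ /=.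
    by rewrite (eqp_rtrans (eqp_scale _ nz_c)) eqp_sym.
  rewrite lead_te lead_coef_redp // lead_coefZ ?scaled_lead //.
rewrite eq_te reconstruct_redp //; last first.
  move=> i; rewrite coefZ; have := small_scaled lt_p; apply: leq_ltn_trans.
  rewrite leq_double !abszM leq_mul2l; apply/orP; right.
  by rewrite -lez_nat !abszE [leRHS]ger0_norm ?onenorm_ge0 // coef_le_onenorm.
by rewrite zprimitiveZ ?gt_eqF ?scale_gt0 // zprimitive_id1.
Qed.

End MainPrime.

(** * Products of distinct primes *)

Lemma next_primeP n : [/\ (n < next_prime n)%N, prime (next_prime n)
  & forall q, prime q -> (n < q)%N -> (next_prime n <= q)%N].
Proof.
rewrite /next_prime; case: ex_minnP => p /andP[lt_np pr_p] min_p.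
by split=> // q pr_q lt_nq; apply: min_p; rewrite lt_nq.
Qed.

(** The i-th term of an increasing sequence of primes is at least the i-th prime;
    the two starting points a <= b make the induction go through, since the
    sequence may skip primes. *)
Lemma iter_next_prime_prod a b (s : seq nat) : (a <= b)%N -> path ltn b s ->
  all prime s ->
  (\prod_(i < size s) iter i.+1 next_prime a <= \prod_(q <- s) q)%N.
Proof.
elim: s a b => [|q s IHs] a b le_ab /=; first by rewrite big_ord0 big_nil.
move=> /andP[lt_bq path_q] /andP[pr_q pr_s].
have [_ _ next_le] := next_primeP a.
have le_nq : (next_prime a <= q)%N by apply: next_le => //; apply: leq_ltn_trans lt_bq.
rewrite big_ord_recl big_cons leq_mul //.
apply: leq_trans (IHs _ _ le_nq path_q pr_s).
by apply: eq_leq; apply: eq_bigr => i _; rewrite -iterSr.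
Qed.

Lemma primorial_le_prod (s : seq nat) : uniq s -> all prime s ->
  (primorial (size s) <= \prod_(q <- s) q)%N.
Proof.
move=> uniq_s pr_s; have perm_s := permEl (perm_sort leq s).
rewrite -(perm_big _ perm_s) -(size_sort leq) /=.
have all_s : all prime (sort leq s) by rewrite (perm_all _ perm_s).
apply: (iter_next_prime_prod (b := 0)) => //.
have : sorted ltn (sort leq s).
  by rewrite ltn_sorted_uniq_leq sort_uniq uniq_s sort_sorted //; exact: leq_total.
by case: (sort leq s) all_s => //= q t /andP[/prime_gt0 -> _] ->.
Qed.

Lemma prod_primes_dvd (s : seq nat) N : uniq s ->
  (forall q, q \in s -> prime q /\ (q %| N)%N) -> (\prod_(q <- s) q %| N)%N.
Proof.
elim: s => [|q s IHs] /=; first by rewrite big_nil dvd1n.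
move=> /andP[q_s uniq_s] dvd_s; have [pr_q q_N] := dvd_s q (mem_head _ _).
have dvd_s' q' : q' \in s -> prime q' /\ (q' %| N)%N.
  by move=> q's; apply: dvd_s; rewrite inE q's orbT.
rewrite big_cons Gauss_dvd ?q_N ?IHs // big_seq.
apply: (big_ind (coprime q)) => [|x y cx cy|x xs]; first exact: coprimen1.
  by rewrite coprimeMr cx.
have [pr_x _] := dvd_s' x xs.
by rewrite prime_coprime // dvdn_prime2 //; apply: contraNneq q_s => ->.
Qed.

Lemma ltn_primorial j : (j < primorial j)%N.
Proof.
apply: leq_trans (ltn_expl j (ltnSn 1)) _.
rewrite -[X in (_ ^ X)%N](card_ord j) -prod_nat_const /primorial.
apply: leq_prod => i _; rewrite /nth_prime iterS.
by have [_ /prime_gt1] := next_primeP (iter i next_prime 0%N).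
Qed.

Lemma fresh_prime (W : nat) (s : seq nat) :
  exists p, [/\ prime p, (W < p)%N & p \notin s].
Proof.
have [p lt_p pr_p] := prime_above (maxn W (\max_(q <- s) q)).
exists p; split=> //; first by apply: leq_ltn_trans lt_p; exact: leq_maxl.
apply/negP => p_s; move: lt_p; rewrite ltnNge => /negP; apply.
by apply: leq_trans (leq_maxr _ _); apply: leq_bigmax_seq.
Qed.

Lemma many_primes (W k : nat) : exists qs : seq nat,
  [/\ size qs = k, uniq qs & forall q, q \in qs -> prime q /\ (W < q)%N].
Proof.
elim: k => [|k [qs [sz_qs uniq_qs pr_qs]]]; first by exists [::].
have [p [pr_p W_p p_qs]] := fresh_prime W qs.
exists (p :: qs); split=> /=; rewrite ?sz_qs ?p_qs // => q.
by rewrite inE => /orP[/eqP->|/pr_qs].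
Qed.

Lemma seq_minP (ds : seq nat) m : m \in ds -> {in ds, forall x, (m <= x)%N} ->
  seq_min ds = m.
Proof.
move=> m_ds min_m; apply/eqP; rewrite eqn_leq /seq_min; apply/andP; split.
  move: (head _ _) => h; elim: ds m_ds {min_m} => //= x ds IHds.
  rewrite inE geq_min => /orP[/eqP->|/IHds->]; by rewrite ?leqnn ?orbT.
have : (m <= head 0 ds)%N.
  by case: ds m_ds min_m => // x ds _ /(_ x (mem_head _ _)).
move: (head _ _) => h le_mh; elim: ds min_m {m_ds} => //= x ds IHds min_m.
rewrite leq_min min_m ?mem_head // IHds // => y y_ds.
by apply: min_m; rewrite inE y_ds orbT.
Qed.

(** * Bounds by natural numbers *)

(** The field R need not be archimedean, but A and M are built from integers by
    operations that preserve being bounded by a natural number. This yields the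
    number of auxiliary primes and the existence of main primes beyond 2 M. *)

Section NatBounded.

Variable R : rcfType.

Definition nat_bounded (x : R) := exists n : nat, 0 <= x <= n%:R.

Lemma nat_bounded_nat n : nat_bounded n%:R.
Proof. by exists n; rewrite ler0n lexx. Qed.

Lemma nat_bounded_le x y : 0 <= x -> x <= y -> nat_bounded y -> nat_bounded x.
Proof. by move=> x0 xy [n /andP[_ yn]]; exists n; rewrite x0 (le_trans xy). Qed.

Lemma nat_boundedM x y : nat_bounded x -> nat_bounded y -> nat_bounded (x * y).
Proof.
move=> [m /andP[x0 xm]] [n /andP[y0 yn]]; exists (m * n)%N.
by rewrite mulr_ge0 // natrM ler_pM.
Qed.

Lemma nat_boundedX x n : nat_bounded x -> nat_bounded (x ^+ n).
Proof.
move=> bx; elim: n => [|n IHn]; first exact: (nat_bounded_nat 1).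
by rewrite exprS; apply: nat_boundedM.
Qed.

Lemma nat_bounded_sqrt x : nat_bounded x -> nat_bounded (Num.sqrt x).
Proof.
move=> [n /andP[x0 xn]]; exists n.+1; rewrite sqrtr_ge0.
rewrite -(@ler_pXn2r _ 2) ?nnegrE ?sqrtr_ge0 // sqr_sqrtr // (le_trans xn) //.
by rewrite -natrX ler_nat; nia.
Qed.

Lemma nat_bounded_norm2 u : nat_bounded (norm2 R u).
Proof.
apply: nat_bounded_sqrt.
have -> : \sum_(i < size u) (u`_i)%:~R ^+ 2 = (`|sqnorm u|%N)%:R :> R.
  rewrite pmulrn gez0_abs ?sqnorm_ge0 // rmorph_sum; apply: eq_bigr => i _.
  by rewrite real_normK ?num_real // rmorphXn.
exact: nat_bounded_nat.
Qed.

Lemma nat_bounded_boundA f g : nat_bounded (boundA R f g).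
Proof.
have norm_bounded u n := nat_boundedX n (nat_bounded_norm2 u).
rewrite /boundA; apply: nat_boundedM (norm_bounded _ _).
apply: nat_boundedM (norm_bounded _ _).
apply: nat_boundedM (nat_bounded_sqrt (nat_bounded_nat _)).
case: (_ - _ - _) => n; first exact/nat_boundedX/(nat_bounded_nat 2).
apply: nat_bounded_le (nat_bounded_nat 1); first by rewrite exprz_ge0.
by rewrite NegzE -exprnN invf_le1 ?exprn_gt0 // exprn_ege1 // ler1n.
Qed.

Lemma nat_bounded_boundM s f g : zcontents f = 1 -> zcontents g = 1 ->
  nat_bounded (boundM R s f g).
Proof.
move=> f1 g1.
have norm_div u : zcontents u = 1 -> nat_bounded (norm2 R u / (lead_coef u)%:~R).
  move=> /lead_coef_primitive_gt0 lu; apply: nat_bounded_le (nat_bounded_norm2 u).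
    by rewrite divr_ge0 ?sqrtr_ge0 // ler0z ltW.
  by rewrite ler_pdivrMr ?ltr0z // ler_peMr ?sqrtr_ge0 // ler1z -gtz0_ge1.
rewrite /boundM; apply: nat_boundedM; last first.
  by have [_|_] := leP (norm2 R f / _) (norm2 R g / _); apply: norm_div.
apply: nat_boundedM; first exact/nat_boundedX/(nat_bounded_nat 2).
exact: nat_bounded_nat.
Qed.

Lemma ex_max_primorial (A : R) : nat_bounded A -> exists k, max_primorial A k.
Proof.
move=> [n /andP[_ A_n]]; pose P j := (primorial j)%:R <= A.
have P_le j : P j -> (j <= n)%N.
  move=> /le_trans/(_ A_n); rewrite ler_nat; apply: leq_trans.
  exact/ltnW/ltn_primorial.
have [/existsP[j0 Pj0]|noP] := boolP [exists j : 'I_n.+1, P j].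
  have exP : exists j, P j by exists j0.
  by case: (ex_maxnP exP P_le) => k Pk max_k; exists k; split=> //; left.
exists 0%N; split; last by right.
move=> j Pj; case/negP: noP; apply/existsP.
by exists (Ordinal (P_le j Pj : (j < n.+1)%N)).
Qed.

End NatBounded.

(** * Executions of the procedure *)

Definition gcd_deg_mod (f g : {poly int}) (q : nat) : nat :=
  deg (gcdp (redp q f) (redp q g)).

Lemma deg_is_gcdp p (e : {poly 'F_p}) f g : is_gcdp e f g -> deg e = gcd_deg_mod f g p.
Proof. by move=> gcd_e; rewrite /gcd_deg_mod /deg (eqp_size gcd_e). Qed.

Section Execution.

Variables (R : rcfType) (f0 g0 : {poly int}).
Hypotheses (nz_f0 : f0 != 0) (nz_g0 : g0 != 0).

Let r := gcdz (zcontents f0) (zcontents g0).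
Let f := zprimitive f0.
Let g := zprimitive g0.

Variables (d F G : {poly int}) (N : int).
Hypotheses (def_f : f = d * F) (def_g : g = d * G) (d1 : zcontents d = 1).
Hypothesis gcd_d : is_gcdZX d f g.
Hypothesis nz_N : N != 0.
Hypothesis N_bound : N = 1 \/ `|N|%:~R <= boundA R f g.
Hypothesis bad_prime_dvd : forall p, prime p -> ~~ (p%:Z %| lcgcd f g)%Z ->
  gcd_deg_mod f g p <> deg d -> (p%:Z %| N)%Z.

Let f1 : zcontents f = 1. Proof. by rewrite zcontents_primitive nz_f0. Qed.
Let g1 : zcontents g = 1. Proof. by rewrite zcontents_primitive nz_g0. Qed.

Definition admissible (q : nat) := prime q /\ ~~ (q%:Z %| lcgcd f g)%Z.

(** An Auxiliary state does not record the primes already used; they are the list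
    done. In a Main state, s is already the true degree of the gcd, and every
    rejected main prime divides N. *)
Definition bpn_invariant (st : bpn_state) : Prop :=
  match st with
  | Input f' g' => f' = f0 /\ g' = g0
  | Primitive r' f' g' => [/\ r' = r, f' = f & g' = g]
  | Auxiliary r' f' g' qs ds =>
    [/\ r' = r, f' = f, g' = g & exists k done,
      [/\ max_primorial (boundA R f g) k, size (done ++ qs) = k.+1,
          uniq (done ++ qs), forall q, q \in done ++ qs -> admissible q
        & ds = map (gcd_deg_mod f g) done /\ all (leq 1) ds]]
  | Main r' f' g' s ps =>
    [/\ [/\ r' = r, f' = f & g' = g], s = deg d, (0 < s)%N, uniq ps
      & forall p, p \in ps -> (p %| `|N|)%N]
  | Output u => is_gcdZX u f0 g0
  end.

Lemma deg_le_gcd_deg_mod q : admissible q -> (deg d <= gcd_deg_mod f g q)%N.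
Proof.
move=> [pr_q q_w].
by rewrite /gcd_deg_mod (deg_gcdp_redp pr_q def_f def_g q_w) leq_addr.
Qed.

(** If all k + 1 primes were bad, their product would divide N, so that the
    primorial of k + 1 would be at most |N| <= A, against the choice of k. When
    N = 1 the bound A may be below 1, but then a single prime suffices. *)
Lemma some_good_prime k (qs : seq nat) : max_primorial (boundA R f g) k ->
  size qs = k.+1 -> uniq qs -> (forall q, q \in qs -> admissible q) ->
  exists2 q, q \in qs & gcd_deg_mod f g q = deg d.
Proof.
move=> [max_k _] sz_qs uniq_qs adm_qs.
have [/hasP[q q_qs /eqP good_q]|/hasPn all_bad] :=
  boolP (has (fun q => gcd_deg_mod f g q == deg d) qs); first by exists q.
have dvd_N q : q \in qs -> prime q /\ (q %| `|N|)%N.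
  move=> q_qs; have [pr_q q_w] := adm_qs q q_qs; split=> //.
  have := bad_prime_dvd pr_q q_w (elimN eqP (all_bad q q_qs)).
  by rewrite dvdzE.
have N_gt0 : (0 < `|N|)%N by rewrite absz_gt0.
have le_N := dvdn_leq N_gt0 (prod_primes_dvd uniq_qs dvd_N).
case: N_bound => [N1|le_A].
  case: qs sz_qs dvd_N {adm_qs all_bad uniq_qs le_N} => // q qs _.
  move=> /(_ q (mem_head _ _)) [pr_q]; rewrite N1 dvdn1 => /eqP q1.
  by rewrite q1 in pr_q.
have: (primorial k.+1)%:R <= boundA R f g.
  apply: le_trans le_A; rewrite -abszE -pmulrn ler_nat; apply: leq_trans le_N.
  rewrite -sz_qs; apply: primorial_le_prod => //.
  by apply/allP => q /dvd_N[].
by move/max_k; rewrite ltnn.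
Qed.

Lemma bpn_invariant_step st st' :
  bpn_step R st st' -> bpn_invariant st -> bpn_invariant st'.
Proof.
move=> step; case: st st' / step => /=.
- by move=> f' g' [-> ->].
- move=> r' f' g' k qs max_k sz_qs uniq_qs adm_qs [def_r' def_f' def_g'].
  move: max_k adm_qs; rewrite def_f' def_g' => max_k adm_qs.
  by split=> //; exists k, [::]; split.
- move=> r' f' g' q qs ds e gcd_e e0 [-> def_f' def_g' [k [done]]].
  move=> [_ _ _ adm _].
  rewrite def_f' def_g' in gcd_e.
  have adm_q : admissible q by apply: adm; rewrite mem_cat mem_head orbT.
  have d_1 : d = 1.
    apply: primitive_const d1 _; move: (deg_le_gcd_deg_mod adm_q).
    by rewrite -(deg_is_gcdp gcd_e) e0 /deg; case: (size d) => [|[|]].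
  rewrite -[_%:P]mulr1 mul_polyC; apply: is_gcdZX_scale.
  by rewrite -d_1; apply: gcd_d.
- move=> r' f' g' q qs ds e gcd_e e0 [-> def_f' def_g'].
  rewrite def_f' def_g' in gcd_e *.
  move=> [k [done [max_k sz_qs uniq_qs adm [-> pos_ds]]]]; split=> //.
  exists k, (rcons done q); rewrite cat_rcons; split=> //.
  rewrite map_rcons -(deg_is_gcdp gcd_e) all_rcons pos_ds andbT.
  by split=> //; rewrite lt0n; apply/eqP.
- move=> r' f' g' ds [-> -> -> [k [done]]]; rewrite cats0.
  move=> [max_k sz_qs uniq_qs adm [-> pos_ds]].
  have [q q_done good_q] := some_good_prime max_k sz_qs uniq_qs adm.
  have d_in : deg d \in map (gcd_deg_mod f g) done by rewrite -good_q map_f.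
  have -> : seq_min (map (gcd_deg_mod f g) done) = deg d.
    apply: seq_minP => // _ /mapP[q' q'_done ->].
    exact/deg_le_gcd_deg_mod/adm.
  by split=> //; exact: (allP pos_ds).
- move=> r' f' g' s ps p e pr_p lt_p p_ps gcd_e deg_e.
  move=> [[-> def_f' def_g'] def_s s_gt0 uniq_ps dvd_ps].
  rewrite def_f' def_g' in gcd_e lt_p *; rewrite def_s in lt_p deg_e s_gt0 *.
  split=> //=; first by rewrite p_ps.
  move=> p'; rewrite inE => /orP[/eqP->|/dvd_ps //].
  have p_w := main_prime_lc def_f def_g f1 g1 d1 lt_p.
  rewrite (deg_is_gcdp gcd_e) in deg_e.
  by have := bad_prime_dvd pr_p p_w deg_e; rewrite dvdzE.
- move=> r' f' g' s ps p e t pr_p lt_p p_ps gcd_e deg_e lead_te.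
  move=> [[-> def_f' def_g'] def_s _ _ _].
  rewrite def_f' def_g' in gcd_e lt_p lead_te; rewrite def_s in lt_p deg_e.
  rewrite (main_output def_f def_g f1 g1 d1 pr_p lt_p gcd_e deg_e lead_te).
  exact: is_gcdZX_scale.
Qed.

Lemma bpn_invariant_reachable st st' :
  bpn_reachable R st st' -> bpn_invariant st -> bpn_invariant st'.
Proof.
by elim=> {st st'} [st st' /bpn_invariant_step | // | st1 st2 st3 _ IH12 _ IH23 /IH12].
Qed.

(** Every other state has a successor: the required k and primes exist, and since
    s > 0 a gcd of degree s is nonzero, so t is obtained by division. *)
Lemma bpn_progress st : bpn_invariant st ->
  (forall st', ~ bpn_step R st st') -> exists u, st = Output u.
Proof.
case: st => [f' g'|r' f' g'|r' f' g' qs ds|r' f' g' s ps|u] /=.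
- by move=> _ /(_ _ (step_primitive R f' g')).
- move=> [-> -> ->] stuck.
  have [k max_k] := ex_max_primorial (nat_bounded_boundA R f g).
  have [qs [sz_qs uniq_qs pr_qs]] := many_primes `|lcgcd f g|%N k.+1.
  case: (stuck _ (step_choose_aux r max_k sz_qs uniq_qs _)) => q /pr_qs[pr_q lt_q].
  split=> //; rewrite dvdzE; apply: contraL lt_q => /dvdn_leq.
  by rewrite -leqNgt; apply; rewrite absz_gt0 gt_eqF ?lcgcd_gt0.
- move=> _ stuck; case: qs stuck => [|q qs] stuck.
    by case: (stuck _ (step_aux_done R r' f' g' ds)).
  have gcd_e : is_gcdp (gcdp (redp q f') (redp q g')) f' g' by apply: eqpxx.
  have [e0|e_neq0] := eqVneq (deg (gcdp (redp q f') (redp q g'))) 0%N.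
    by case: (stuck _ (step_aux_stop R r' qs ds gcd_e e0)).
  by case: (stuck _ (step_aux_next R r' qs ds gcd_e (elimN eqP e_neq0))).
- move=> [[-> -> ->] def_s s_gt0 _ _] stuck.
  have [n /andP[_ le_n]] := nat_bounded_boundM R s f1 g1.
  have [p [pr_p lt_p p_ps]] := fresh_prime (2 * n) ps.
  have lt_Mp : 2 * boundM R s f g < p%:R.
    apply: le_lt_trans (_ : (2 * n)%:R < _); last by rewrite ltr_nat.
    by rewrite natrM ler_pM2l ?ltr0n.
  set e := gcdp (redp p f) (redp p g).
  have gcd_e : is_gcdp e f g by apply: eqpxx.
  have [deg_e|deg_e] := eqVneq (deg e) s; last first.
    by case: (stuck _ (step_main_repeat r pr_p lt_Mp p_ps gcd_e (elimN eqP deg_e))).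
  have nz_e : e != 0.
    by apply: contraTneq s_gt0 => e0; rewrite -deg_e e0 /deg size_poly0.
  case: (stuck _ (step_main_output (t := (lcgcd f g)%:~R / lead_coef e)
     r pr_p lt_Mp p_ps gcd_e deg_e _)).
  by rewrite lead_coefZ divfK // lead_coef_eq0.
- by exists u.
Qed.

Lemma infinite_run_step st : bpn_infinite_run R st ->
  exists2 st', bpn_step R st st' & bpn_infinite_run R st'.
Proof.
move=> [run [<- steps]]; exists (run 1%N) => //.
by exists (fun i => run i.+1); split.
Qed.

Lemma no_infinite_run_output u : ~ bpn_infinite_run R (Output u).
Proof. by move=> /infinite_run_step[st' step]; inversion step. Qed.

(** The rejected primes are distinct divisors of N, so there are at most |N| + 1
    of them (0 is counted in the crude interval used here). *)
Lemma no_infinite_run_main n r' f' g' s ps :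
  bpn_invariant (Main r' f' g' s ps) -> (`|N|.+1 < n + size ps)%N ->
  ~ bpn_infinite_run R (Main r' f' g' s ps).
Proof.
elim: n ps => [|n IHn] ps inv.
  have [_ _ _ uniq_ps dvd_ps] := inv.
  have: {subset ps <= iota 0 `|N|.+1}.
    move=> p /dvd_ps /dvdn_leq; rewrite absz_gt0 mem_iota => /(_ nz_N) //.
  by move=> /(uniq_leq_size uniq_ps); rewrite size_iota add0n leqNgt => /negP.
move=> le_n /infinite_run_step[st' step].
have := bpn_invariant_step step inv.
inversion step => inv'; last exact: no_infinite_run_output.
by apply: IHn inv' _; rewrite /= addnS.
Qed.

Lemma no_infinite_run_auxiliary r' f' g' qs ds :
  bpn_invariant (Auxiliary r' f' g' qs ds) ->
  ~ bpn_infinite_run R (Auxiliary r' f' g' qs ds).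
Proof.
elim: qs ds => [|q qs IHqs] ds inv /infinite_run_step[st' step];
  have := bpn_invariant_step step inv; inversion step => inv'.
- by apply: (no_infinite_run_main (n := `|N|.+2)) => //; rewrite addn0.
- exact: no_infinite_run_output.
exact: IHqs.
Qed.

Lemma no_infinite_run_input : ~ bpn_infinite_run R (Input f0 g0).
Proof.
have inv0 : bpn_invariant (Input f0 g0) by [].
move=> /infinite_run_step[st1 step1]; have := bpn_invariant_step step1 inv0.
inversion step1 => inv1 /infinite_run_step[st2 step2].
have := bpn_invariant_step step2 inv1.
by inversion step2 => inv2; apply: no_infinite_run_auxiliary.
Qed.

End Execution.

(* There is no infinite execution, and an execution can only come to a halt
   in an output state, whose value is then a gcd of f and g. *)
Theorem mainTheorem4 (R : rcfType) (f g : {poly int})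
    (hf : f != 0) (hg : g != 0) :
  ~ bpn_infinite_run R (Input f g) /\
  (forall st : bpn_state,
     bpn_reachable R (Input f g) st ->
     (forall st' : bpn_state, ~ bpn_step R st st') ->
     exists2 d : {poly int}, st = Output d & is_gcdZX d f g).
Proof.
have f1 : zcontents (zprimitive f) = 1 by rewrite zcontents_primitive hf.
have g1 : zcontents (zprimitive g) = 1 by rewrite zcontents_primitive hg.
have [d [F [G [[def_f def_g d1 coFG] gcd_d]]]] := primitive_gcd f1 g1.
have [N [nz_N N_bound bad]] := exceptional_integer def_f def_g f1 g1 d1 coFG.
have N_boundR : N = 1 \/ `|N|%:~R <= boundA R (zprimitive f) (zprimitive g).
  by case: N_bound => [|/(_ R)]; [left | right].
split.
  exact: (no_infinite_run_input hf hg def_f def_g d1 gcd_d nz_N N_boundR bad).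
move=> st reach stuck.
have inv := bpn_invariant_reachable hf hg def_f def_g d1 gcd_d nz_N N_boundR
  bad reach (conj erefl erefl).
have [u def_st] := bpn_progress hf hg inv stuck.
by exists u; move: inv; rewrite def_st.
Qed.
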